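(* Let $k\in\mathbb{Z}$. If $k$ is even, then the primes (arith $k$) are exactly the usual prime numbers. If $k$ is odd, then the primes (arith $k$) are exactly the powers of two $2^s$ with $s\ge 1$ an integer.
   Context: For $m,n,k\in\mathbb{Z}$ the $k$-arithmetic product is $m\odot_k n=(m-n+1)\cdot n+\frac{n(n-1)k}{2}\in\mathbb{Z}$, where the operations on the right are the usual ones. (For $n>0$ this is the sum of the $n$ terms of the arithmetic progression with first term $m-n+1$ and difference $k$.) An integer $d>0$ is called a divisor of $a\in\mathbb{Z}$ (arith $k$) if there exists $b\in\mathbb{Z}$ such that $b\odot_k d=a$; divisors are always positive. An integer $p>1$ is called a prime (arith $k$), or $k$-prime, if it has exactly two divisors (arith $k$). *)

(* Defs.v *)
From mathcomp Require Import all_boot all_order all_algebra.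
Set Implicit Arguments.
Unset Strict Implicit.
Unset Printing Implicit Defensive.
Import Order.TTheory GRing.Theory Num.Theory.
Local Open Scope ring_scope.

(* The Euclidean quotient by 2 is exact, since n * (n - 1) is even. *)
Definition arith_mul (k m n : int) : int :=
  (m - n + 1) * n + (n * (n - 1) * k %/ 2)%Z.

Definition arith_divisor (k d a : int) : Prop :=
  0 < d /\ exists b : int, arith_mul k b d = a.

Definition arith_prime (k p : int) : Prop :=
  1 < p /\
  exists d1 d2 : int, d1 <> d2 /\
    forall d : int, arith_divisor k d p <-> d = d1 \/ d = d2.

(* Main.v *)
Require Import Defs.
From mathcomp Require Import all_boot all_order all_algebra.
From mathcomp Require Import zify ring.
Set Implicit Arguments.
Unset Strict Implicit.
Unset Printing Implicit Defensive.
Import Order.TTheory GRing.Theory Num.Theory.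
Local Open Scope ring_scope.

(** Doubling [arith_mul k b d = a] gives [d * (2 (b - d + 1) + (d - 1) k) = 2 a], so
    [d] divides [a] (arith [k]) iff [2 a = d * c] with [c] of the parity of
    [(d - 1) k].  For even [k] this is usual divisibility; for odd [k] it says
    that [2 a] is the product of [d] and a cofactor of opposite parity.  In the
    latter case [2 ^ v * m] with [m] odd has the divisors [1], [m] and
    [2 ^ (v + 1)], and there are no others when [m = 1]. *)

Lemma dvdz2_mul_pred (n : int) : (2 %| n * (n - 1))%Z.
Proof.
have [e [->|->]] : exists e : int, n = e * 2 \/ n = e * 2 + 1.
- by exists (n %/ 2)%Z; lia.
- by rewrite -mulrA mulrCA dvdz_mulr.
- by rewrite addrK mulrA dvdz_mull.
Qed.

Lemma arith_mul2 (k m n : int) :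
  arith_mul k m n * 2 = n * ((m - n + 1) * 2 + (n - 1) * k).
Proof.
by rewrite /arith_mul mulrDl divzK; [ring | rewrite dvdz_mulr ?dvdz2_mul_pred].
Qed.

Lemma arith_divisorP (k d a : int) :
  arith_divisor k d a <->
  0 < d /\ exists c : int, d * c = a * 2 /\ (2 %| c - (d - 1) * k)%Z.
Proof.
split=> [[d_gt0 [b <-]]|[d_gt0 [c [dc /dvdzP[q cE]]]]]; split=> //.
  exists ((b - d + 1) * 2 + (d - 1) * k).
  by rewrite arith_mul2 addrK dvdz_mull.
(* With [c = q * 2 + (d - 1) * k], this [b] solves [c = (b - d + 1) * 2 + (d - 1) * k]. *)
exists (q + d - 1).
apply: (@mulIf _ 2) => //; rewrite arith_mul2 -dc; congr (_ * _).
by rewrite -[c](subrK ((d - 1) * k)) cE; ring.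
Qed.

Lemma arith_divisor_even (k d a : int) : (2 %| k)%Z ->
  arith_divisor k d a <-> 0 < d /\ (d %| a)%Z.
Proof.
move=> k2; split=> [/arith_divisorP[d_gt0 [c [dc]]]|[d_gt0 /dvdzP[q ->]]].
  rewrite rpredBr ?dvdz_mull // => /dvdzP[q cE]; split=> //.
  apply/dvdzP; exists q; apply: (@mulIf _ 2) => //.
  by rewrite -dc cE; ring.
apply/arith_divisorP; split=> //; exists (q * 2); split; first by ring.
by rewrite rpredBr ?dvdz_mull.
Qed.

(** For odd [k], [(d - 1) * k] has the parity of [d - 1], so the cofactor [c] must differ from [d]
    in parity. Positivity of [d] and [n] keeps [c] in [nat]. *)
Lemma arith_divisor_odd (k : int) (d n : nat) : ~~ (2 %| k)%Z -> (0 < n)%N ->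
  arith_divisor k d n <-> exists c : nat, (d * c = n * 2)%N /\ odd (d + c).
Proof.
move=> k2 n_gt0.
have par (c : int) : (2 %| c - (d%:Z - 1) * k)%Z = ~~ (2 %| d%:Z + c)%Z.
  have [j ->] : exists j : int, k = j * 2 + 1 by exists (k %/ 2)%Z; lia.
  rewrite (_ : c - _ = (d%:Z + c - 1) + (j * (1 - d%:Z) - d%:Z + 1) * 2).
    (* Abstracting the nonlinear factor of 2 leaves a linear parity goal. *)
    by move: (_ + 1) => t; lia.
  by ring.
split=> [/arith_divisorP[d_gt0 [c [dc]]]|[c [dc odc]]].
  rewrite par => odc.
  have c_ge0 : 0 <= c by rewrite -(pmulr_rge0 _ d_gt0) dc; lia.
  by case: c c_ge0 dc odc => // c _ dc odc; exists c; split; lia.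
apply/arith_divisorP; split; first by case: d dc {par odc}; lia.
by exists c; rewrite par; split; lia.
Qed.

(** Pigeonhole on the two divisors; it turns three known divisors into an equation. *)
Lemma arith_prime_collision (k p x y z : int) : arith_prime k p ->
  arith_divisor k x p -> arith_divisor k y p -> arith_divisor k z p ->
  [\/ x = y, x = z | y = z].
Proof.
move=> [_ [d1 [d2 [_ H]]]] /H[]-> /H[]-> /H[]->;
by [constructor 1 | constructor 2 | constructor 3].
Qed.

Lemma arith_prime_even (k p : int) : (2 %| k)%Z ->
  arith_prime k p <-> exists q : nat, prime q /\ p = q%:Z.
Proof.
move=> k2; split=> [Hp|[q [q_pr ->]]].
  have [p_gt1 _] := Hp; case: p p_gt1 Hp => // q q_gt1 Hp.
  exists q; split=> //; apply/primeP; split=> // d dq.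
  have d_gt0 : (0 < d)%N by apply: dvdn_gt0 dq; lia.
  have div (e : nat) : (0 < e)%N -> (e %| q)%N -> arith_divisor k e q.
    by move=> e_gt0 eq; apply/(arith_divisor_even _ _ k2).
  have q_gt0 : (0 < q)%N by lia.
  (* Since [1 < q], a coincidence among [1], [d], [q] forces [d = 1] or [d = q]. *)
  have := arith_prime_collision Hp (div 1%N isT (dvd1n q))
    (div d d_gt0 dq) (div q q_gt0 (dvdnn q)).
  by case; lia.
have q_gt1 := prime_gt1 q_pr; split; first by lia.
exists 1, q%:Z; split=> [|d]; first by lia.
split=> [/(arith_divisor_even _ _ k2)[]|dE].
  case: d => // d _ dq; have /primeP[_ /(_ d dq)] := q_pr.
  by case/orP=> /eqP->; [left | right].
by apply/(arith_divisor_even _ _ k2); case: dE => ->; rewrite ?dvd1z ?dvdzz; lia.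
Qed.

Lemma odd_dvdn_exp2 (d s : nat) : odd d -> (d %| 2 ^ s)%N -> d = 1%N.
Proof.
move=> od ds; apply/eqP; rewrite -dvdn1.
by rewrite -(@Gauss_dvdl _ _ (2 ^ s)) ?mul1n // coprimeXr ?coprimen2.
Qed.

Lemma arith_prime_odd (k p : int) : ~~ (2 %| k)%Z ->
  arith_prime k p <-> exists s : nat, (1 <= s)%N /\ p = 2 ^+ s.
Proof.
move=> k2; split=> [Hp|[s [s_gt0 ->]]].
  have [p_gt1 _] := Hp; case: p p_gt1 Hp => // n n_gt1 Hp.
  have n_gt0 : (0 < n)%N by lia.
  have [v [m om nE]] : exists v, exists2 m, odd m & n = (2 ^ v * m)%N.
    have [m co nE] := pfactor_coprime (isT : prime 2) n_gt0.
    by exists (logn 2 n), m; rewrite -?coprime2n 1?mulnC.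
  have div (d c : nat) : (d * c = n * 2)%N -> odd (d + c) -> arith_divisor k d n.
    by move=> dc odc; apply/(arith_divisor_odd _ k2 n_gt0); exists c.
  have E : (2 ^ v.+1 * m = n * 2)%N by rewrite nE expnSr mulnAC.
  have e2 : ~~ odd (2 ^ v.+1) by rewrite oddX.
  have D1 : arith_divisor k 1%N n by apply: (div _ (n * 2)%N); lia.
  have D2 : arith_divisor k m n by apply: (div _ (2 ^ v.+1)%N); lia.
  have D3 : arith_divisor k (2 ^ v.+1)%N n by apply: (div _ m); lia.
  (* Both [1] and [m] are odd while [2 ^ v.+1] is even, so only [1 = m] can occur. *)
  have m1 : m = 1%N by case: (arith_prime_collision Hp D1 D2 D3); lia.
  exists v; move: nE; rewrite m1 muln1 => nE; split; last by rewrite nE -natz natrX.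
  by case: v nE {E e2 D3} => //; lia.
have -> : (2 : int) ^+ s = (2 ^ s)%N by rewrite -natz natrX.
have s_gt1 : (1 < 2 ^ s)%N by rewrite -(expn0 2) ltn_exp2l.
have p_gt0 := ltnW s_gt1; split; first by lia.
(* The second divisor is [2 ^ s.+1], not [2 ^ s]: the latter has cofactor [2], and both are even. *)
exists 1, (2 ^ s.+1)%N; split=> [|d]; first by rewrite expnS; lia.
split=> [Hd|].
  case: d Hd => [d|d [] //] /(arith_divisor_odd _ k2 p_gt0)[c []].
  rewrite -expnSr oddD => dc odc.
  (* Exactly one of [d] and [c] is odd; as a divisor of [2 ^ s.+1] it equals [1], which determines
     [d]. *)
  have [od|ed] := boolP (odd d).
    by left; rewrite (@odd_dvdn_exp2 d s.+1) // -dc dvdn_mulr.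
  right; rewrite -dc (@odd_dvdn_exp2 c s.+1) ?muln1 //; last by rewrite -dc dvdn_mull.
  by rewrite (negPf ed) in odc.
have e2 : ~~ odd (2 ^ s.+1) by rewrite oddX.
case=> ->; apply/(arith_divisor_odd _ k2 p_gt0).
  by exists (2 ^ s.+1)%N; rewrite mul1n expnSr; lia.
by exists 1%N; rewrite muln1 -expnSr; lia.
Qed.

Theorem theorem2 (k : int) :
  ((2 %| k)%Z ->
     forall p : int,
       arith_prime k p <-> exists q : nat, prime q /\ p = q%:Z) /\
  (~~ (2 %| k)%Z ->
     forall p : int,
       arith_prime k p <-> exists s : nat, (1 <= s)%N /\ p = 2 ^+ s).
Proof.
by split=> k2 p; [exact: arith_prime_even | exact: arith_prime_odd].
Qed.
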